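(* Let $M$ be a compact (Hausdorff) space, let $C(M)$ be the Banach space of real-valued continuous functions on $M$ with the supremum norm, let $V$ be a finite-dimensional linear subspace of $C(M)$, and let $P$ be a linear projection from $C(M)$ onto $V$. Then $\mathcal{LE}_c(V)\le\|P\|$. Consequently, if $P$ is a projection of minimal norm from $C(M)$ onto $V$, then \[ \mathcal{PC}(V)=\mathcal{LE}(V)=\mathcal{LE}_c(V)=\|P\|. \]
   Context: For a function $f$ from a subset $X$ of a metric space $(Z,\rho)$ into a Banach space $V$, $L(f)=\sup\{\|f(x)-f(y)\|/\rho(x,y): x\neq y\}$. $\mathcal{LE}(V)$ is the infimum of the constants $c$ such that for every metric space $(Z,\rho)$, every $X\subseteq Z$ and every $f:X\to V$ there is an extension $g:Z\to V$ of $f$ with $L(g)\le cL(f)$; $\mathcal{LE}_c(V)$ is defined the same way but using only compact metric spaces $Z$. $\mathcal{PC}(V)$ is the infimum of the constants $c$ such that for every Banach space $W$ into which $V$ is isometrically embedded there is a linear projection of $W$ onto $V$ of norm at most $c$. *)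

(* Defs.v *)
From HB Require Import structures.
From mathcomp Require Import all_boot all_order all_algebra.
From mathcomp Require Import all_classical all_reals all_analysis.
Set Implicit Arguments. Unset Strict Implicit. Unset Printing Implicit Defensive.
Import Order.TTheory GRing.Theory Num.Theory.
Import numFieldNormedType.Exports.
Local Open Scope classical_set_scope.
Local Open Scope ring_scope.

Section Defs.
Variable R : realType.

(* supremum norm of a (bounded) real function on M; sup of empty set is 0 *)
Definition supnorm (M : Type) (f : M -> R) : R := sup [set `|f x| | x in [set: M]].

Definition fd_subspace (M : topologicalType) (V : set (M -> R)) : Prop :=
  [/\ (forall v, V v -> continuous v),
      V (fun _ => 0),
      (forall u v, V u -> V v -> V (fun x => u x + v x)),
      (forall (a : R) v, V v -> V (fun x => a * v x)) &
      exists (n : nat) (b : 'I_n -> M -> R),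
        (forall i, V (b i)) /\
        forall v, V v -> exists a : 'I_n -> R, forall x, v x = \sum_(i < n) a i * b i x].

Definition is_projection (M : topologicalType) (V : set (M -> R))
    (P : (M -> R) -> (M -> R)) : Prop :=
  [/\ (forall f g, continuous f -> continuous g ->
          P (fun x => f x + g x) = (fun x => P f x + P g x)),
      (forall (a : R) f, continuous f -> P (fun x => a * f x) = (fun x => a * P f x)),
      (forall f, continuous f -> V (P f)) &
      (forall v, V v -> P v = v)].

Definition opnorm (M : topologicalType) (P : (M -> R) -> (M -> R)) : \bar R :=
  ereal_sup [set (supnorm (P f))%:E | f in [set f : M -> R | continuous f /\ supnorm f <= 1]].

Definition is_metric (Z : Type) (d : Z -> Z -> R) : Prop :=
  [/\ (forall x y, 0 <= d x y),
      (forall x y, d x y = 0 <-> x = y),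
      (forall x y, d x y = d y x) &
      (forall x y z, d x z <= d x y + d y z)].

Definition metric_open (Z : Type) (d : Z -> Z -> R) (O : set Z) : Prop :=
  forall x, O x -> exists2 e : R, 0 < e & forall y, d x y < e -> O y.

Definition metric_compact (Z : Type) (d : Z -> Z -> R) : Prop :=
  forall F : set (set Z), (forall O, F O -> metric_open d O) ->
    (forall z, exists2 O, F O & O z) ->
    exists s : seq (set Z), (forall O, O \in s -> F O) /\
      (forall z, exists2 O, O \in s & O z).

(* Lipschitz constant L(f) of f : X -> V (values compared in sup norm);
   the sup over the empty family is taken to be 0 *)
Definition lipconst (M Z : Type) (d : Z -> Z -> R) (X : set Z) (f : Z -> M -> R) : \bar R :=
  ereal_sup ([set 0%E] `|`
    [set r | exists x y, [/\ X x, X y, x <> y &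
       r = ((supnorm (fun m => f x m - f y m)) / d x y)%:E]]).

Definition ext_const (M : topologicalType) (V : set (M -> R))
    (Z : Type) (d : Z -> Z -> R) (c : R) : Prop :=
  forall (X : set Z) (f : Z -> M -> R), (forall x, X x -> V (f x)) ->
    exists g : Z -> M -> R, (forall z, V (g z)) /\ (forall x, X x -> g x = f x) /\
      (lipconst d setT g <= c%:E * lipconst d X f)%E.

Definition LE (M : topologicalType) (V : set (M -> R)) : \bar R :=
  ereal_inf [set c%:E | c in [set c : R | 0 <= c /\
    forall (Z : Type) (d : Z -> Z -> R), is_metric d -> ext_const V d c]].

Definition LEc (M : topologicalType) (V : set (M -> R)) : \bar R :=
  ereal_inf [set c%:E | c in [set c : R | 0 <= c /\
    forall (Z : Type) (d : Z -> Z -> R), is_metric d -> metric_compact d -> ext_const V d c]].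

Definition isom_embedding (M : topologicalType) (V : set (M -> R))
    (W : normedModType R) (J : (M -> R) -> W) : Prop :=
  (forall (a : R) u v, V u -> V v -> J (fun x => a * u x + v x) = a *: J u + J v) /\
  (forall v, V v -> `|J v| = supnorm v).

Definition PC (M : topologicalType) (V : set (M -> R)) : \bar R :=
  ereal_inf [set c%:E | c in [set c : R | 0 <= c /\
    forall (W : completeNormedModType R) (J : (M -> R) -> W), isom_embedding V J ->
      exists Q : W -> W,
        [/\ (forall (a : R) w1 w2, Q (a *: w1 + w2) = a *: Q w1 + Q w2),
            (forall w, exists2 v, V v & Q w = J v),
            (forall v, V v -> Q (J v) = J v) &
            (forall w, `|Q w| <= c * `|w|)]]].

End Defs.

(* Main.v *)
Require Import Defs.
From HB Require Import structures.
From mathcomp Require Import all_boot all_order all_algebra.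
From mathcomp Require Import all_classical all_reals all_analysis.
From mathcomp Require Import ring lra.
Set Implicit Arguments. Unset Strict Implicit. Unset Printing Implicit Defensive.
Import Order.TTheory GRing.Theory Num.Theory.
Import numFieldNormedType.Exports.
Local Open Scope classical_set_scope.
Local Open Scope ring_scope.

(* The four quantities are compared along [LEc <= ||P||], [LEc <= LE <= PC <= LEc]
   and, for minimal [P], [||P|| <= PC].
   - [LEc <= ||P||]: extend [f] pointwise on [M] by McShane's formula
     [inf_x (f x m + L d(x, z))]; total boundedness of the domain makes the
     extension continuous in [m], and [P] can be applied to it.
   - [LE <= PC] and [||P|| <= PC]: [V] sits in the Banach space of all bounded
     functions on [M], which contains [C(M)]. McShane's extension always takes
     values there, and a projection from it onto [V] restricts to [C(M)].
   - [PC <= LEc]: let [V] be embedded in [W]. Extending the identity of [V]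
     from finite subsets of [W] and passing to an ultralimit gives a
     [c]-Lipschitz retraction [W -> V]. Averaging with an invariant mean, first
     over [V] and then over [W], turns it into a linear one with the same
     constant. *)

(** * The Banach space of bounded functions *)

Definition is_bounded (R : realType) (M : Type) (f : M -> R) : Prop :=
  exists C, forall x, `|f x| <= C.

Section Supnorm.
Variables (R : realType) (M : Type).
Implicit Types f g : M -> R.

Lemma supnorm_ub f x : is_bounded f -> `|f x| <= supnorm f.
Proof.
move=> [C fC]; apply: ub_le_sup; last by exists x.
by exists C => _ [y _ <-].
Qed.

(** The sign condition on [C] covers empty [M], where the supremum takes the default value 0. *)
Lemma supnorm_le f C : 0 <= C -> (forall x, `|f x| <= C) -> supnorm f <= C.
Proof.
move=> C0 fC; have [[x _]|/set0P/negP/negPn/eqP M0] := pselect ([set: M] !=set0).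
  by apply: ge_sup; [exists `|f x|, x | move=> _ [y _ <-]].
by rewrite /supnorm M0 image_set0 sup0.
Qed.

Lemma supnorm_ge0 f : 0 <= supnorm f.
Proof.
rewrite /supnorm; set E := image _ _.
(* An empty or unbounded set of values has supremum 0 by convention. *)
have [[[y [x _ fxy]] ubE]|/sup_out ->//] := pselect (has_sup E).
by rewrite (le_trans (normr_ge0 (f x)))// ub_le_sup//; exists x.
Qed.

Lemma supnorm_eq0 f : is_bounded f -> supnorm f = 0 -> f = fun=> 0.
Proof.
move=> bf f0; apply/funext => x; apply/eqP.
by rewrite -normr_le0 -f0 supnorm_ub.
Qed.

Lemma is_boundedD f g :
  is_bounded f -> is_bounded g -> is_bounded (fun x => f x + g x).
Proof.
move=> [C fC] [D gD]; exists (C + D) => x.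
by rewrite (le_trans (ler_normD _ _)) ?lerD.
Qed.

Lemma is_boundedZ a f : is_bounded f -> is_bounded (fun x => a * f x).
Proof.
by move=> [C fC]; exists (`|a| * C) => x; rewrite normrM ler_wpM2l.
Qed.

Lemma supnormZ a f : is_bounded f -> supnorm (fun x => a * f x) = `|a| * supnorm f.
Proof.
move=> bf; apply/eqP; rewrite eq_le; apply/andP; split.
  apply: supnorm_le => [|x]; first by rewrite mulr_ge0 ?supnorm_ge0.
  by rewrite normrM ler_wpM2l ?supnorm_ub.
have [->|a0] := eqVneq a 0; first by rewrite normr0 mul0r supnorm_ge0.
rewrite -ler_pdivlMl ?normr_gt0//; apply: supnorm_le => [|x].
  by rewrite mulr_ge0 ?invr_ge0 ?supnorm_ge0.
rewrite ler_pdivlMl ?normr_gt0// -normrM.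
exact/(@supnorm_ub (fun x => a * f x))/is_boundedZ.
Qed.

End Supnorm.

Section Linfty.
Variables (R : realType) (M : Type).

(** [R^o] is [R] as a module over itself, so that [M -> R^o] is a module from which the subtype
    inherits its structure. *)
Definition linfty_pred : {pred M -> R^o} := mem [set f : M -> R^o | is_bounded f].

Lemma linfty_submod_closed : submod_closed linfty_pred.
Proof.
split; first by rewrite inE; exists 0 => x; rewrite normr0.
move=> a f g; rewrite !inE => bf bg.
exact: is_boundedD (is_boundedZ a bf) bg.
Qed.

HB.instance Definition _ := GRing.isSubmodClosed.Build _ _ linfty_pred
  linfty_submod_closed.

Record linfty := Linfty { linfty_fun :> M -> R^o; _ : linfty_fun \in linfty_pred }.

HB.instance Definition _ := [isSub for linfty_fun].
HB.instance Definition _ := [Choice of linfty by <:].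
HB.instance Definition _ := [SubChoice_isSubLmodule of linfty by <:].

Lemma linfty_bounded (f : linfty) : is_bounded f.
Proof. by case: f => f /=; rewrite inE. Qed.

Definition linfty_norm (f : linfty) : R := supnorm f.

Lemma linfty_normD f g : linfty_norm (f + g) <= linfty_norm f + linfty_norm g.
Proof.
apply: supnorm_le => [|x]; first by rewrite addr_ge0 ?supnorm_ge0.
rewrite (le_trans (ler_normD _ _))// lerD//.
  exact: (supnorm_ub _ (linfty_bounded f)).
exact: (supnorm_ub _ (linfty_bounded g)).
Qed.

Lemma linfty_normZ a f : linfty_norm (a *: f) = `|a| * linfty_norm f.
Proof. exact: supnormZ (linfty_bounded f). Qed.

Lemma linfty_norm_eq0 f : linfty_norm f = 0 -> f = 0.
Proof. by move=> f0; apply/val_inj/(supnorm_eq0 (linfty_bounded f) f0). Qed.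

HB.instance Definition _ := @Lmodule_isNormed.Build R linfty linfty_norm
  linfty_normD linfty_normZ linfty_norm_eq0.

Lemma linfty_normE (f : linfty) : `|f| = supnorm f. Proof. by []. Qed.

Lemma le_linfty_norm (f : linfty) x : `|f x| <= `|f|.
Proof. exact: supnorm_ub (linfty_bounded f). Qed.

(** Evaluations are 1-Lipschitz, so a Cauchy filter converges pointwise. The Cauchy bound is uniform
    in the point and survives in the limit, which gives both boundedness of the limit and
    convergence in norm. *)
Lemma linfty_complete (F : set_system linfty) :
  ProperFilter F -> cauchy F -> cvg F.
Proof.
move=> FF /cauchy_ballP Fc.
have {}Fc (e : R) : 0 < e -> \forall f \near F, \forall g \near F, `|f - g| < e.
  by move=> e0; apply: nearP_dep; have := Fc e e0; rewrite -ball_normE.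
pose ev x : linfty -> R := fun f => f x.
have cvx x : cvg (ev x @ F).
  apply: cauchy_cvg; apply: cauchy_exP => e e0; near F => f.
  exists (f x); rewrite -ball_normE /=.
  apply: (@filterS _ F _ [set g | `|f - g| < e]); last by near: f; exact: Fc.
  by move=> g; exact/le_lt_trans/(le_linfty_norm (f - g) x).
pose l x : R := lim (ev x @ F).
have key (e : R) : 0 < e -> \forall f \near F, forall x, `|ev x f - l x| <= e.
  move=> e0; near=> f => x; apply/ler_addgt0Pr => d d0; near F => g.
  rewrite (le_trans (ler_distD (g x) _ _))// lerD//.
    rewrite (le_trans (le_linfty_norm (f - g) x))// ltW//.
    by near: g; near: f; exact: Fc.
  rewrite distrC ltW//; near: g.
  by have /cvgrPdist_lt/(_ _ d0) := cvx x.
have bl : (l : M -> R^o) \in linfty_pred.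
  rewrite inE; near F => f; have [C fC] := linfty_bounded f.
  exists (1 + C) => x; rewrite -[l x](subrK (f x)) (le_trans (ler_normD _ _))//.
  by rewrite lerD// distrC; move: (x); near: f; exact: key.
apply/cvg_ex; exists (Linfty bl); apply/cvgrPdist_le => e e0.
apply: filterS (key _ e0) => f fe; apply: supnorm_le => [|x]; first exact: ltW.
by rewrite distrC; exact: fe.
Unshelve. all: by end_near. Qed.

HB.instance Definition _ := Uniform_isComplete.Build linfty linfty_complete.

End Linfty.

(** * Generalized limits *)

Section GeneralizedLimits.
Variable R : realType.

Definition ev_bounded (I : Type) (F : set_system I) (f : I -> R) : Prop :=
  exists C : R, \forall i \near F, `|f i| <= C.

(* For [F := globally A], these are the finitely additive means supported on
   [A]. *)
Definition generalized_limit (I : Type) (F : set_system I)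
    (L : (I -> R) -> R) : Prop :=
  [/\ forall a f g, ev_bounded F f -> ev_bounded F g ->
        L (fun i => a * f i + g i) = a * L f + L g,
      forall f C, (\forall i \near F, `|f i| <= C) -> `|L f| <= C &
      forall c, L (fun=> c) = c].

Section Theory.
Variables (I : Type) (F : set_system I) (L : (I -> R) -> R).
Hypotheses (FF : ProperFilter F) (hL : generalized_limit F L).

Lemma ev_boundedN f : ev_bounded F f -> ev_bounded F (fun i => - f i).
Proof. by move=> [C fC]; exists C; apply: filterS fC => i; rewrite normrN. Qed.

Lemma ev_boundedD f g : ev_bounded F f -> ev_bounded F g ->
  ev_bounded F (fun i => f i + g i).
Proof.
move=> [C fC] [D gD]; exists (C + D); near=> i.
by rewrite (le_trans (ler_normD _ _))// lerD//; near: i.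
Unshelve. all: by end_near. Qed.

Lemma ev_boundedZ a f : ev_bounded F f -> ev_bounded F (fun i => a * f i).
Proof.
move=> [C fC]; exists (`|a| * C); apply: filterS fC => i fi.
by rewrite normrM ler_wpM2l.
Qed.

Lemma ev_bounded_cst c : ev_bounded F (fun=> c).
Proof. by exists `|c|; exact: nearW. Qed.

Lemma generalized_limitD f g : ev_bounded F f -> ev_bounded F g ->
  L (fun i => f i + g i) = L f + L g.
Proof.
case: hL => + _ _ bf bg => /(_ 1 f g bf bg); rewrite mul1r => <-.
by congr L; apply/funext => i; rewrite mul1r.
Qed.

Lemma generalized_limitZ a f : ev_bounded F f ->
  L (fun i => a * f i) = a * L f.
Proof.
case: hL => + _ L_cst bf => /(_ a f _ bf (ev_bounded_cst 0)).
by rewrite L_cst addr0 => <-; congr L; apply/funext => i; rewrite addr0.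
Qed.

Lemma generalized_limitB f g : ev_bounded F f -> ev_bounded F g ->
  L (fun i => f i - g i) = L f - L g.
Proof.
move=> bf bg; rewrite generalized_limitD//; last exact: ev_boundedN.
by under eq_fun do rewrite -mulN1r; rewrite generalized_limitZ// mulN1r.
Qed.

Lemma generalized_limit_le f C :
  (\forall i \near F, `|f i| <= C) -> `|L f| <= C.
Proof. by case: hL => _ + _; exact. Qed.

(** The difference [f - c] is eventually bounded by 0, hence so is its limit. *)
Lemma generalized_limit_near f c : (\forall i \near F, f i = c) -> L f = c.
Proof.
move=> fc; have bf : ev_bounded F f.
  by exists `|c|; apply: filterS fc => i ->.
have -> : f = fun i => f i - c + c by apply/funext => i; rewrite subrK.
have bfc := ev_boundedD bf (ev_boundedN (ev_bounded_cst c)).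
rewrite generalized_limitD//; last exact: ev_bounded_cst.
case: hL => _ _ ->; apply/eqP; rewrite -[eqbRHS]add0r (inj_eq (addIr _)) -normr_le0.
apply: generalized_limit_le; apply: filterS fc => i ->.
by rewrite subrr normr0.
Qed.

End Theory.

Lemma ultra_map (I T : Type) (f : I -> T) (U : set_system I) :
  UltraFilter U -> UltraFilter (f @ U).
Proof.
move=> UU; split => [|G GG UG]; first exact: fmap_proper_filter.
apply/seteqP; split=> // A GA.
have [//|/(UG (~` A)) GnA] := in_ultra_setVsetC (f @^-1` A) UU.
by exfalso; apply: (filter_not_empty G); rewrite -(setICr A); exact: filterI.
Qed.

(** Take limits along an ultrafilter finer than [F]: an eventually bounded function pushes it
    forward to an ultrafilter on a compact segment, which converges. *)
Lemma generalized_limit_exists (I : Type) (F : set_system I) :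
  ProperFilter F -> exists L, generalized_limit F L.
Proof.
move=> FF; have [U [UU FU]] := ultraFilterLemma FF.
have cvU f : ev_bounded F f -> cvg (f @ U).
  move=> [C fC]; have : (f @ U) `[- C, C]%classic.
    by apply: FU; apply: filterS fC => i /=; rewrite in_itv /= ler_norml.
  have := @segment_compact R (- C) C; rewrite compact_ultra => cC.
  by move=> /(cC _ (ultra_map _ UU))[l [_ fl]]; apply/cvg_ex; exists l.
exists (fun f => lim (f @ U)); split.
- move=> a f g /cvU cf /cvU cg; apply/cvg_lim => //.
  by apply: cvgD => //; apply: cvgMr.
- move=> f C fC; have cf : cvg (f @ U) by apply: cvU; exists C.
  apply/ler_addgt0Pr => e e0; near U => i.
  rewrite -[lim _](subrK (f i)) (le_trans (ler_normD _ _))//.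
  rewrite [leRHS]addrC lerD//; last by near: i; apply: FU.
  by rewrite ltW//; near: i; move/cvgrPdist_lt : cf => /(_ _ e0).
- by move=> c; exact: lim_cst.
Unshelve. all: by end_near. Qed.

End GeneralizedLimits.

(** * Invariant means *)

Section InvariantMean.
Variables (R : realType) (G : zmodType).

(** Følner average: the mean of [h] over the box of points [u + \sum_i a_i *+ n_i], with [a_i]
    running through [s] and [0 <= n_i <= N]. *)
Fixpoint box_avg (N : nat) (s : seq G) (h : G -> R) : G -> R :=
  if s is a :: s' then
    fun u => (\sum_(n < N.+1) box_avg N s' h (u + a *+ n)) / N.+1%:R
  else h.

Lemma box_avg_linear N s a f g u :
  box_avg N s (fun x => a * f x + g x) u =
  a * box_avg N s f u + box_avg N s g u.
Proof.
elim: s u => //= b s IH u; rewrite mulrA -mulrDl; congr (_ / _).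
by rewrite mulr_sumr -big_split; apply: eq_bigr => n _; rewrite IH.
Qed.

Lemma box_avg_cst N s c u : box_avg N s (fun=> c) u = c.
Proof.
elim: s u => //= b s IH u; under eq_bigr do rewrite IH.
by rewrite sumr_const card_ord -[c *+ _]mulr_natr mulfK.
Qed.

Lemma box_avg_shift N s h a u :
  box_avg N s (fun x => h (x + a)) u = box_avg N s h (u + a).
Proof.
elim: s u => //= b s IH u; congr (_ / _).
by apply: eq_bigr => n _; rewrite IH addrAC.
Qed.

Lemma avg_le N (f : nat -> R) C : (forall n, `|f n| <= C) ->
  `|(\sum_(n < N.+1) f n) / N.+1%:R| <= C.
Proof.
move=> fC; rewrite normrM normfV [`|N.+1%:R|]ger0_norm ?ler0n//.
rewrite ler_pdivrMr ?ltr0n// (le_trans (ler_norm_sum _ _ _))//.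
have := @ler_sum R _ (index_enum 'I_N.+1) xpredT (fun n => `|f n|) (fun=> C).
by rewrite sumr_const card_ord mulr_natr; apply => n _; exact: fC.
Qed.

Variable A : set G.
Hypotheses (A0 : A 0) (AD : forall x y, A x -> A y -> A (x + y)).

Let AMn a n : A a -> A (a *+ n).
Proof. by move=> Aa; elim: n => [|n IH]; rewrite ?mulr0n// mulrS; exact: AD. Qed.

Lemma box_avg_le N s h C u : (forall x, A x -> `|h x| <= C) ->
  (forall a, a \in s -> A a) -> A u -> `|box_avg N s h u| <= C.
Proof.
move=> hC; elim: s u => [|b s IH] u sA Au /=; first exact: hC.
apply: (@avg_le N (fun n => box_avg N s h (u + b *+ n))) => n; apply: IH.
  by move=> a sa; apply: sA; rewrite inE sa orbT.
by apply: AD => //; apply: AMn; apply: sA; rewrite mem_head.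
Qed.

(** In the direction [a] the difference telescopes to two end terms, divided by [N + 1]. Averaging
    over the other directions preserves the bound. *)
Lemma box_avg_almost_invariant N s h C a u : (forall x, A x -> `|h x| <= C) ->
  (forall a, a \in s -> A a) -> a \in s -> A u ->
  `|box_avg N s h (u + a) - box_avg N s h u| <= 2 * C / N.+1%:R.
Proof.
move=> hC; elim: s u => [//|b s IH] u sA + Au.
have sA' x : x \in s -> A x by move=> sx; apply: sA; rewrite inE sx orbT.
have Ab : A b by apply: sA; rewrite mem_head.
rewrite inE => /orP[/eqP ->|sa] /=.
  set k := box_avg N s h; rewrite -mulrBl.
  have -> : \sum_(n < N.+1) k (u + b + b *+ n) - \sum_(n < N.+1) k (u + b *+ n)
      = k (u + b *+ N.+1) - k u.
    under eq_bigr do rewrite -addrA -mulrS.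
    rewrite big_ord_recr/= [X in _ - X]big_ord_recl/= mulr0n addr0.
    by under [X in _ - (_ + X)]eq_bigr do rewrite /bump /=; ring.
  rewrite normrM normfV [`|N.+1%:R|]ger0_norm ?ler0n// ler_wpM2r//.
  rewrite (le_trans (ler_normB _ _))// mulr_natl mulr2n.
  by apply: lerD; apply: box_avg_le => //; apply: AD => //; exact: AMn.
rewrite -mulrBl -sumrB.
under eq_bigr do rewrite addrAC.
apply: (@avg_le N (fun n => box_avg N s h (u + b *+ n + a) -
  box_avg N s h (u + b *+ n))) => n.
by apply: IH => //; apply: AD => //; exact: AMn.
Qed.

(** Abelian groups are amenable: box averages are nearly invariant under the members of [s], and a
    generalized limit along growing [s] and [N] removes the error. *)
Lemma invariant_mean_exists : exists m : (G -> R) -> R,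
  generalized_limit (globally A) m /\
  forall h a, ev_bounded (globally A) h -> A a ->
    m (fun x => h (x + a)) = m h.
Proof.
(* Tails of the directed set of pairs (finite list in [A], box size), ordered by inclusion and
   size. *)
pose B (p : seq G * nat) := [set q : seq G * nat |
  [/\ {subset p.1 <= q.1}, (forall a, a \in q.1 -> A a) & (p.2 <= q.2)%N]].
pose D := [set p : seq G * nat | forall a, a \in p.1 -> A a].
have FF : ProperFilter (filter_from D B).
  apply: filter_from_proper; last by move=> p Dp; exists p; split.
  apply: filter_from_filter; first by exists ([::], 0%N).
  move=> p q Dp Dq; exists (p.1 ++ q.1, maxn p.2 q.2).
    by move=> a /=; rewrite mem_cat => /orP[/Dp|/Dq].
  move=> r [/= s1 s2 s3]; split; split=> //.
  - by move=> a pa; apply: s1; rewrite mem_cat pa.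
  - by rewrite (leq_trans _ s3)// leq_maxl.
  - by move=> a pa; apply: s1; rewrite mem_cat pa orbT.
  - by rewrite (leq_trans _ s3)// leq_maxr.
have [L hL] := generalized_limit_exists R FF.
pose av h (p : seq G * nat) := box_avg p.2 p.1 h 0.
have avC h C : (forall x, A x -> `|h x| <= C) ->
    \forall p \near filter_from D B, `|av h p| <= C.
  move=> hC; exists ([::], 0%N) => // p [_ pA _]; exact: box_avg_le.
have avb h : ev_bounded (globally A) h -> ev_bounded (filter_from D B) (av h).
  by move=> [C hC]; exists C; apply: avC.
exists (fun h => L (av h)); split; first split.
- move=> a f g /avb bf /avb bg; have [Llin _ _] := hL; rewrite -Llin//.
  by congr L; apply/funext => p; exact: box_avg_linear.
- by move=> f C fC; apply: (generalized_limit_le hL); exact: avC.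
- move=> c; have [_ _ L_cst] := hL; rewrite -[RHS]L_cst.
  by congr L; apply/funext => p; exact: box_avg_cst.
- move=> h a bh Aa; have [C hC] := bh; apply/eqP; rewrite -subr_eq0.
  have bha : ev_bounded (globally A) (fun x => h (x + a)).
    by exists C => x Ax; apply: hC; exact: AD.
  rewrite -(generalized_limitB FF hL (avb _ bha) (avb _ bh)).
  have C0 : 0 <= C by rewrite (le_trans _ (hC _ A0)).
  rewrite -normr_le0; apply/ler_addgt0Pr => e e0; rewrite add0r.
  have [n ne] : exists n, 2 * C / n.+1%:R <= e.
    exists (Num.truncn (2 * C / e)); rewrite ler_pdivrMr ?ltr0n// [leRHS]mulrC.
    rewrite -ler_pdivrMr//.
    by rewrite ltW// truncnS_gt.
  apply: (generalized_limit_le hL).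
  (* From here on every box has [a] among its directions and side at least [n], so the shift error
     is at most [e]. *)
  exists ([:: a], n); first by move=> b /=; rewrite inE => /eqP ->.
  move=> p [/= sp pA np]; rewrite /av box_avg_shift.
  rewrite (le_trans (box_avg_almost_invariant p.2 hC pA _ A0))//.
    by apply: sp; rewrite mem_head.
  rewrite (le_trans _ ne)// ler_wpM2l ?mulr_ge0//.
  by rewrite lef_pV2 ?posrE ?ltr0n// ler_nat ltnS.
Qed.

End InvariantMean.

(** * Finite-dimensional function spaces *)

(* Induction on the number of generators: subtracting [h i m0 * v0] with
   [v0 m0 = 1] moves [h] into the hyperplane of functions vanishing at [m0]. *)
Lemma span_generalized_limit (R : realType) (M I : Type) (F : set_system I)
    (L : (I -> R) -> R) (n : nat) (V : set (M -> R)) (b : 'I_n -> M -> R)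
    (h : I -> M -> R) :
  ProperFilter F -> generalized_limit F L ->
  V (fun=> 0) ->
  (forall u v, V u -> V v -> V (fun x => u x + v x)) ->
  (forall a v, V v -> V (fun x => a * v x)) ->
  (forall i, V (b i)) ->
  (forall v, V v -> exists a : 'I_n -> R, forall x, v x = \sum_(i < n) a i * b i x) ->
  (forall i, V (h i)) ->
  (forall x, ev_bounded F (h ^~ x)) ->
  V (fun x => L (h ^~ x)).
Proof.
move=> FF hL; elim: n => [|n IH] in V b h * => V0 VD VZ Vb bspan Vh hb.
  have -> // : (fun x => L (h ^~ x)) = fun=> 0.
  apply/funext => x; apply: (generalized_limit_near FF hL); apply: nearW => i.
  by have [a ->] := bspan _ (Vh i); rewrite big_ord0.
have [[m0 [i0 bm0]]|b0] := pselect (exists m i, b i m != 0); last first.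
  have -> // : (fun x => L (h ^~ x)) = fun=> 0.
  apply/funext => x; apply: (generalized_limit_near FF hL); apply: nearW => i.
  have [a ->] := bspan _ (Vh i); apply: big1 => j _.
  have [->|bj] := eqVneq (b j x) 0; first by rewrite mulr0.
  by exfalso; apply: b0; exists x, j.
pose v0 x := (b i0 m0)^-1 * b i0 x.
have Vv0 : V v0 by exact: VZ.
have v0m0 : v0 m0 = 1 by rewrite /v0 mulVf.
pose red (v : M -> R) x := v x + (- v m0) * v0 x.
have Vred v : V v -> V (red v) by move=> Vv; apply: VD => //; exact: VZ.
have redm0 v : red v m0 = 0 by rewrite /red v0m0 mulr1 subrr.
have hbm0 x : ev_bounded F (fun i => v0 x * h i m0) by exact: ev_boundedZ.
have rb x : ev_bounded F (fun i => red (h i) x).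
  apply: ev_boundedD => //.
  have -> : (fun i => - h i m0 * v0 x) = fun i => (- v0 x) * h i m0.
    by apply/funext => i; ring.
  exact: ev_boundedZ.
have [] := IH (fun v => V v /\ v m0 = 0)
  (fun j => red (b (lift i0 j))) (fun i => red (h i)).
- by [].
- by move=> u v [Vu u0] [Vv vm0]; split; [exact: VD | rewrite u0 vm0 addr0].
- by move=> a v [Vv vm0]; split; [exact: VZ | rewrite vm0 mulr0].
- by move=> j; split; [exact: Vred | exact: redm0].
- move=> v [Vv vm0]; have [a va] := bspan _ Vv.
  exists (fun j => a (lift i0 j)) => x.
  under eq_bigr do rewrite /red mulrDr mulNr mulrN mulrA.
  rewrite sumrB -mulr_suml.
  have sumE y : \sum_(j < n) a (lift i0 j) * b (lift i0 j) y = v y - a i0 * b i0 y.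
    by rewrite va (bigD1_ord i0)//= addrAC subrr add0r.
  by rewrite !sumE vm0 /v0; field.
- by move=> i; split; [exact: Vred | exact: redm0].
- exact: rb.
move=> VL _; have -> : (fun x => L (h ^~ x)) =
    fun x => L (fun i => red (h i) x) + L (h ^~ m0) * v0 x.
  apply/funext => x; rewrite mulrC -(generalized_limitZ FF hL)//.
  rewrite -(generalized_limitD hL)//.
  by congr L; apply/funext => i; rewrite /red; ring.
by apply: VD => //; exact: VZ.
Qed.

Lemma fd_generalized_limit (R : realType) (M : topologicalType)
    (V : set (M -> R)) (I : Type) (F : set_system I) (L : (I -> R) -> R)
    (h : I -> M -> R) :
  fd_subspace V -> ProperFilter F -> generalized_limit F L ->
  (forall i, V (h i)) -> (forall x, ev_bounded F (h ^~ x)) ->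
  V (fun x => L (h ^~ x)).
Proof.
move=> [_ V0 VD VZ [n [b [Vb bspan]]]] FF hL Vh hb.
exact: (span_generalized_limit FF hL V0 VD VZ Vb bspan Vh hb).
Qed.

(* If [n a = k + r] with [k] an integer and [0 <= r < 1], then
   [n (phi a - a phi 1) = phi r - r phi 1] is bounded independently of [n]. *)
Lemma additive_bounded_homogeneous (R : realType) (phi : R -> R) (C : R) :
  (forall x y, phi (x + y) = phi x + phi y) ->
  (forall x, `|phi x| <= C * `|x|) ->
  forall a, phi a = a * phi 1.
Proof.
move=> phiD phiC a.
have phi0 : phi 0 = 0 by have := phiD 0 0; rewrite addr0 => /eqP; lra.
have phin n x : phi (x *+ n) = phi x *+ n.
  by elim: n => [|n IH]; rewrite ?mulr0n// !mulrS phiD IH.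
have phiN x : phi (- x) = - phi x.
  by have := phiD x (- x); rewrite subrr phi0; lra.
have phiz (k : int) : phi k%:~R = k%:~R * phi 1.
  case: k => n; first by rewrite -pmulrn phin mulr_natl.
  by rewrite NegzE mulrNz -pmulrn phiN phin mulNr mulr_natl.
have key n : `|phi a - a * phi 1| *+ n <= 2 * C.
  pose k := Num.floor (a *+ n); pose r := a *+ n - k%:~R.
  have r0 : 0 <= r by rewrite subr_ge0 floor_le.
  have r1 : r <= 1 by rewrite lerBlDl ltW// -intrD1 floorD1_gt.
  have e : (phi a - a * phi 1) *+ n = phi r - r * phi 1.
    rewrite /r phiD phiN phin phiz mulrnBl mulrBl mulrnAl; ring.
  rewrite -normrMn e (le_trans (ler_normB _ _))//.
  have C0 : `|phi 1| <= C by have := phiC 1; rewrite normr1 mulr1.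
  have := phiC r; have := normr_ge0 (phi 1); rewrite normrM (ger0_norm r0).
  move: (`|phi r|) (`|phi 1|) C0 => x y yC y0 xCr.
  have : r * y <= C by rewrite (le_trans _ yC)// ler_piMl.
  have : C * r <= C by rewrite ler_piMr// (le_trans y0).
  lra.
apply/eqP; rewrite -subr_eq0 -normr_le0 leNgt; apply/negP => d0.
have := key (Num.truncn (2 * C / `|phi a - a * phi 1|)).+1.
by rewrite -[leLHS]mulr_natl -ler_pdivlMr// leNgt truncnS_gt.
Qed.

(** * From Lipschitz to linear retractions *)

Section Lipschitz.
Variables (R : realType) (M Z : Type) (d : Z -> Z -> R).
Hypothesis dm : is_metric d.
Implicit Types (X : set Z) (f : Z -> M -> R) (K : R).

Lemma is_metric_xx x : d x x = 0.
Proof. by case: dm => _ d0 _ _; exact/d0. Qed.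

Lemma is_metric_gt0 x y : x <> y -> 0 < d x y.
Proof.
case: dm => dge0 d0 _ _ xy; rewrite lt_neqAle dge0 andbT eq_sym.
by apply/eqP => /d0.
Qed.

Lemma lipconst_ge0 X f : (0 <= lipconst d X f)%E.
Proof. by apply: ereal_sup_ubound; left. Qed.

Lemma lipconst_le X f K : 0 <= K ->
  (forall x y, X x -> X y -> forall m, `|f x m - f y m| <= K * d x y) ->
  (lipconst d X f <= K%:E)%E.
Proof.
move=> K0 fK; apply: ge_ereal_sup => _ [->|[x [y [Xx Xy xy ->]]]].
  by rewrite lee_fin.
have d0 := is_metric_gt0 xy; rewrite lee_fin ler_pdivrMr//.
by apply: supnorm_le => [|m]; [rewrite mulr_ge0// ltW | exact: fK].
Qed.

Lemma lipconst_ub X f K x y m : (lipconst d X f <= K%:E)%E -> X x -> X y ->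
  is_bounded (fun m => f x m - f y m) -> `|f x m - f y m| <= K * d x y.
Proof.
move=> fK Xx Xy bf; have [->|xy] := pselect (x = y).
  by rewrite is_metric_xx mulr0 subrr normr0.
have d0 := is_metric_gt0 xy; rewrite (le_trans (supnorm_ub m bf))//.
rewrite -ler_pdivrMr// -lee_fin (le_trans _ fK)//.
by apply: ereal_sup_ubound; right; exists x, y.
Qed.

End Lipschitz.

Lemma finite_metric_compact (R : realType) (Z : finType) (d : Z -> Z -> R) :
  metric_compact d.
Proof.
move=> F _ Fcov.
have /choice[B HB] : forall z, exists B, F B /\ B z.
  by move=> z; have [B FB Bz] := Fcov z; exists B.
exists [seq B z | z <- enum Z]; split.
  by move=> _ /mapP[z _ ->]; case: (HB z).
by move=> z; exists (B z); [rewrite map_f// mem_enum | case: (HB z)].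
Qed.

Lemma continuous_is_bounded (R : realType) (M : topologicalType) (f : M -> R) :
  compact [set: M] -> continuous f -> is_bounded f.
Proof.
move=> cM cf; have /compact_bounded[N [_ NM]] : compact (f @` [set: M]).
  by apply: continuous_compact => //; exact: continuous_subspaceT.
by exists (N + 1) => x; apply: (NM (N + 1)); [rewrite ltrDl | exists x].
Qed.

Section Linearization.
Variables (R : realType) (M : topologicalType) (V : set (M -> R)).
Hypotheses (cM : compact [set: M]) (fdV : fd_subspace V).

Lemma fd_bounded v : V v -> is_bounded v.
Proof. by case: fdV => cV _ _ _ _ /cV; exact: continuous_is_bounded. Qed.

Lemma fd_sub u v : V u -> V v -> V (fun x => u x - v x).
Proof.
case: fdV => _ _ VD VZ _ Vu Vv; have -> : (fun x => u x - v x) =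
  (fun x => u x + (-1) * v x) by apply/funext => x; rewrite mulN1r.
exact: VD (VZ _ _ Vv).
Qed.

Variables (W : normedModType R) (J : (M -> R) -> W).
Hypothesis hJ : isom_embedding V J.

Lemma isom_embedding0 : J (fun=> 0) = 0.
Proof.
case: fdV => _ V0 _ _ _; apply/eqP; rewrite -normr_le0 hJ.2//.
by apply: supnorm_le => // x; rewrite normr0.
Qed.

Lemma isom_embeddingD u v : V u -> V v -> J (fun x => u x + v x) = J u + J v.
Proof.
move=> Vu Vv; rewrite -[J u]scale1r -hJ.1//.
by congr J; apply/funext => x; rewrite mul1r.
Qed.

Lemma isom_embedding_dist u v : V u -> V v ->
  `|J u - J v| = supnorm (fun x => u x - v x).
Proof.
move=> Vu Vv; rewrite -hJ.2; last exact: fd_sub.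
congr `| _ |; apply/eqP; rewrite subr_eq -isom_embeddingD//; last exact: fd_sub.
by apply/eqP; congr J; apply/funext => x; rewrite subrK.
Qed.

Lemma isom_embedding_inj u v : V u -> V v -> J u = J v -> u = v.
Proof.
move=> Vu Vv Juv; have := isom_embedding_dist Vu Vv.
rewrite Juv subrr normr0 => /esym/(supnorm_eq0 (fd_bounded (fd_sub Vu Vv))) uv.
by apply/funext => x; apply/eqP; rewrite -subr_eq0 (congr1 (@^~ x) uv).
Qed.

Variable c : R.
Hypotheses (c0 : 0 <= c)
  (hc : forall (Z : Type) (d : Z -> Z -> R),
     is_metric d -> metric_compact d -> ext_const V d c).

(** A finite subset of [W] is a compact metric space, so the constant [c] applies to it. The map to
    extend is the inverse of [J] on the points of [S] in the image of [V]; it is an isometry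
    there. *)
Lemma finite_retraction (S : seq W) : exists g : W -> M -> R,
  [/\ forall w, V (g w),
      forall w1 w2 m, w1 \in S -> w2 \in S ->
        `|g w1 m - g w2 m| <= c * `|w1 - w2| &
      forall v, V v -> J v \in S -> g (J v) = v].
Proof.
have V0 : V (fun=> 0) by case: fdV.
pose d (x y : seq_sub S) := `|val x - val y|.
have dm : is_metric d.
  split=> [x y|x y|x y|x y z]; rewrite /d.
  - exact: normr_ge0.
  - split=> [/eqP|->]; last by rewrite subrr normr0.
    by rewrite normr_eq0 subr_eq0 => /eqP/val_inj.
  - exact: distrC.
  - exact: ler_distD.
pose E (z : seq_sub S) := [set v | V v /\ J v = val z].
pose X := [set z | E z !=set0].
pose f z := xget (fun=> 0) (E z).
have fX z : X z -> V (f z) /\ J (f z) = val z.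
  by move=> [v Ev]; exact: (xgetPex _ (ex_intro _ v Ev)).
have [g [Vg [gf gL]]] := hc dm (@finite_metric_compact _ _ d)
  (fun z Xz => (fX z Xz).1).
have {}gL : (lipconst d setT g <= c%:E)%E.
  rewrite (le_trans gL)// -[leRHS]mule1 lee_wpmul2l ?lee_fin//.
  apply: lipconst_le => // x y Xx Xy m; rewrite mul1r.
  have [Vx Jx] := fX _ Xx; have [Vy Jy] := fX _ Xy.
  rewrite /d -Jx -Jy isom_embedding_dist//.
  exact: (supnorm_ub m (fd_bounded (fd_sub Vx Vy))).
(* The value 0 off [S] is arbitrary; it only has to lie in [V]. *)
exists (fun w => if insub w is Some z then g z else fun=> 0); split.
- by move=> w; case: insubP.
- move=> w1 w2 m S1 S2; rewrite !insubT/=.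
  exact: (lipconst_ub dm m gL I I (fd_bounded (fd_sub (Vg _) (Vg _)))).
- move=> v Vv SJv; rewrite insubT/=.
  have Xz : X (SeqSub SJv) by exists v.
  rewrite gf//; have [Vf Jf] := fX _ Xz.
  exact: isom_embedding_inj.
Qed.

(** Take a generalized limit of the retractions over finite sets ordered by inclusion. Each
    condition involves at most two points of [W], so it holds eventually; finite dimension keeps the
    limit in [V]. *)
Lemma lipschitz_retraction : exists g : W -> M -> R,
  [/\ forall w, V (g w),
      forall w1 w2 m, `|g w1 m - g w2 m| <= c * `|w1 - w2| &
      forall v, V v -> g (J v) = v].
Proof.
have V0 : V (fun=> 0) by case: fdV.
have /choice[g /all_and3[Vg gL gJ]] := finite_retraction.
pose F := filter_from setT (fun S0 : seq W => [set S : seq W | {subset S0 <= S}]).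
have FF : ProperFilter F.
  apply: filter_from_proper; last by move=> S _; exists S => w.
  apply: filter_from_filter; first by exists [::].
  move=> S S' _ _; exists (S ++ S') => // S'' sS; split=> w Sw.
    by apply: sS; rewrite mem_cat Sw.
  by apply: sS; rewrite mem_cat Sw orbT.
have [L hL] := generalized_limit_exists R FF.
have gb w m : ev_bounded F (fun S => g S w m).
  (* Once [S] contains 0, the retraction vanishes there, and the Lipschitz condition bounds its
     value at [w]. *)
  exists (c * `|w|), [:: w; 0] => // S sS.
  have Sw : w \in S by apply: sS; rewrite inE eqxx.
  have S0 : 0 \in S by apply: sS; rewrite !inE eqxx orbT.
  have := gL S w 0 m Sw S0; rewrite !subr0.
  by have /= := gJ S (fun=> 0) V0; rewrite isom_embedding0 => -> //; rewrite subr0.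
exists (fun w m => L (fun S => g S w m)); split.
- by move=> w; apply: (fd_generalized_limit fdV FF hL).
- move=> w1 w2 m; rewrite -(generalized_limitB FF hL)//.
  apply: (generalized_limit_le hL); exists [:: w1; w2] => // S sS.
  by apply: gL; apply: sS; rewrite !inE eqxx ?orbT.
- move=> v Vv; apply/funext => m; apply: (generalized_limit_near FF hL).
  by exists [:: J v] => // S sS; rewrite gJ//; apply: sS; rewrite mem_head.
Qed.

(** Average [g (w + a) - g a] over [a] in the image of [V]. Moving [w] by [J v] amounts to shifting
    [a], which the mean ignores, except that the subtracted term changes by [v]. *)
Lemma equivariant_retraction : exists g : W -> M -> R,
  [/\ forall w, V (g w),
      forall w1 w2 m, `|g w1 m - g w2 m| <= c * `|w1 - w2| &
      forall w v, V v -> g (w + J v) = fun m => g w m + v m].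
Proof.
have [_ V0 VD _ _] := fdV.
have [g [Vg gL gJ]] := lipschitz_retraction.
pose A := [set w | exists2 v, V v & J v = w].
have A0 : A 0 by exists (fun=> 0) => //; exact: isom_embedding0.
have AD x y : A x -> A y -> A (x + y).
  move=> [u Vu <-] [v Vv <-]; exists (fun m => u m + v m); first exact: VD.
  exact: isom_embeddingD.
have FF : ProperFilter (globally A) by exact: globally_properfilter A0.
have [m [hm minv]] := invariant_mean_exists R A0 AD.
(* On [A], [g a] is the inverse image of [a] under [J]. *)
pose h w p a := g (w + a) p - g a p.
have hb w p : ev_bounded (globally A) (h w p).
  by exists (c * `|w|) => a _; rewrite (le_trans (gL _ _ _))// addrK.
exists (fun w p => m (h w p)); split.
- move=> w; apply: (fd_generalized_limit fdV FF hm (h := fun a p => h w p a)).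
    by move=> a; exact: fd_sub.
  by move=> p; exact: hb.
- move=> w1 w2 p; rewrite -(generalized_limitB FF hm)//.
  apply: (generalized_limit_le hm) => a _.
  rewrite /h opprB addrA subrK (le_trans (gL _ _ _))//.
  by rewrite opprD addrACA subrr addr0.
- move=> w v Vv; apply/funext => p.
  have AJv : A (J v) by exists v.
  have bs : ev_bounded (globally A) (fun a => h w p (a + J v)).
    by have [C hC] := hb w p; exists C => a Aa; apply: hC; exact: AD.
  rewrite -(minv _ _ (hb w p) AJv) [RHS]addrC; apply/eqP; rewrite -subr_eq.
  rewrite -(generalized_limitB FF hm)//; apply/eqP.
  apply: (generalized_limit_near FF hm) => _ [u Vu <-].
  rewrite /h -isom_embeddingD// !gJ//; last exact: VD.
  rewrite isom_embeddingD// [J u + J v]addrC addrA; ring.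
Qed.

(** Average the increments [g (u + w) - g u] over all [u] in [W]. Invariance makes the mean additive
    in [w], and its bound makes it homogeneous. By equivariance the increment along [J v] is
    constantly [v], so the retraction property survives. *)
Lemma linear_retraction : exists T : W -> M -> R,
  [/\ forall w, V (T w),
      forall a w1 w2 m, T (a *: w1 + w2) m = a * T w1 m + T w2 m,
      forall w m, `|T w m| <= c * `|w| &
      forall v, V v -> T (J v) = v].
Proof.
have [g [Vg gL gJ]] := equivariant_retraction.
have FF : ProperFilter (globally [set: W]) by exact: (globally_properfilter (a := 0)).
have [m [hm minv]] := invariant_mean_exists R (A := [set: W]) I (fun _ _ _ _ => I).
pose h w p u := g (u + w) p - g u p.
have hC w p u : `|h w p u| <= c * `|w|.
  by rewrite (le_trans (gL _ _ _))// addrAC subrr add0r.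
have hb w p : ev_bounded (globally [set: W]) (h w p).
  by exists (c * `|w|) => u _.
have TD p w1 w2 : m (h (w1 + w2) p) = m (h w1 p) + m (h w2 p).
  rewrite -(minv _ w1 (hb w2 p) I) -(generalized_limitD hm)//; last first.
    by exists (c * `|w2|) => u _.
  by congr m; apply/funext => u; rewrite /h addrA; ring.
have TC w p : `|m (h w p)| <= c * `|w|.
  by apply: (generalized_limit_le hm) => u _.
exists (fun w p => m (h w p)); split=> //.
- move=> w; apply: (fd_generalized_limit fdV FF hm (h := fun u p => h w p u)).
    by move=> u; exact: fd_sub.
  by move=> p; exact: hb.
- move=> a w1 w2 p; rewrite TD; congr (_ + _).
  have := @additive_bounded_homogeneous _ (fun a => m (h (a *: w1) p)) (c * `|w1|).
  rewrite scale1r; apply=> [x y|x]; first by rewrite scalerDl TD.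
  by rewrite (le_trans (TC _ _))// normrZ [`|x| * _]mulrC mulrA.
- move=> v Vv; apply/funext => p; apply: (generalized_limit_near FF hm) => u _.
  by rewrite /h gJ// addrAC subrr add0r.
Qed.

End Linearization.

Lemma PC_le_LEc (R : realType) (M : topologicalType) (V : set (M -> R)) :
  compact [set: M] -> fd_subspace V -> (PC V <= LEc V)%E.
Proof.
move=> cM fdV; apply: le_ereal_inf => _ [c [c0 hc] <-].
exists c => //; split=> // W J hJ.
have [T [VT Tlin TC TJ]] := linear_retraction cM fdV hJ c0 hc.
exists (fun w => J (T w)); split.
- move=> a w1 w2; rewrite -hJ.1//; congr J.
  by apply/funext => m; exact: Tlin.
- by move=> w; exists (T w).
- by move=> v Vv; rewrite TJ.
- move=> w; rewrite hJ.2//; apply: supnorm_le => [|m]; last exact: TC.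
  by rewrite mulr_ge0.
Qed.

(** * McShane extensions and projections *)

Lemma le_inf_image (R : realType) (Z : Type) (X : set Z) (phi psi : Z -> R) e :
  X !=set0 -> has_lbound (phi @` X) ->
  (forall x, X x -> phi x <= psi x + e) ->
  inf (phi @` X) <= inf (psi @` X) + e.
Proof.
move=> [x0 Xx0] lphi pe; rewrite -lerBlDr.
apply: lb_le_inf; first by exists (psi x0), x0.
move=> _ [x Xx <-]; rewrite lerBlDr (le_trans _ (pe _ Xx))//.
by apply: ge_inf => //; exists x.
Qed.

Section McShane.
Variables (R : realType) (M Z : Type) (d : Z -> Z -> R) (X : set Z).
Variables (f : Z -> M -> R) (K : R).

Definition mcshane (z : Z) (m : M) : R :=
  inf [set f x m + K * d x z | x in X].

Hypotheses (dm : is_metric d) (X0 : X !=set0) (K0 : 0 <= K)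
  (fK : forall x y, X x -> X y -> forall m, `|f x m - f y m| <= K * d x y).

Lemma mcshane_has_lbound z m : has_lbound [set f x m + K * d x z | x in X].
Proof.
have [x0 Xx0] := X0; have [_ _ dC dD] := dm.
(* This is a bound since [f x m >= f x0 m - K * d x x0] and [d x x0 <= d x z + d x0 z]. *)
exists (f x0 m - K * d x0 z) => _ [x Xx <-].
have := fK Xx Xx0 m; rewrite ler_norml => /andP[+ _].
have := ler_wpM2l K0 (dD x0 z x); rewrite (dC z x) (dC x0 x) mulrDr.
have := ler_wpM2l K0 (dD x z x0); rewrite (dC z x0) mulrDr.
lra.
Qed.

Lemma mcshane_extends x : X x -> mcshane x = f x.
Proof.
move=> Xx; apply/funext => m; apply/eqP; rewrite eq_le; apply/andP; split.
  apply: ge_inf; first exact: mcshane_has_lbound.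
  by exists x => //; rewrite is_metric_xx// mulr0 addr0.
apply: lb_le_inf; first by exists (f x m + K * d x x), x.
move=> _ [y Xy <-]; have := fK Xy Xx m; rewrite ler_norml => /andP[+ _].
lra.
Qed.

Lemma mcshane_lipschitz z z' m :
  `|mcshane z m - mcshane z' m| <= K * d z z'.
Proof.
have [_ _ dC dD] := dm.
suff key u v : mcshane u m <= mcshane v m + K * d u v.
  have := key z z'; have := key z' z; rewrite (dC z' z) ler_norml; lra.
apply: le_inf_image => //; first exact: mcshane_has_lbound.
move=> x Xx; rewrite -addrA lerD2l -mulrDr ler_wpM2l//.
by rewrite (dC u v); exact: dD.
Qed.

Lemma mcshane_bounded z :
  (forall x, X x -> is_bounded (f x)) -> is_bounded (mcshane z).
Proof.
have [x0 Xx0] := X0; move=> /(_ _ Xx0)[C fC].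
exists (C + K * d z x0) => m; rewrite -[mcshane z m](subrK (f x0 m)) addrC.
rewrite (le_trans (ler_normD _ _))// lerD//.
by rewrite -(mcshane_extends Xx0); exact: mcshane_lipschitz.
Qed.

Lemma mcshane_dist z m m' e : (forall x, X x -> `|f x m - f x m'| <= e) ->
  `|mcshane z m - mcshane z m'| <= e.
Proof.
move=> fe; suff key p q : (forall x, X x -> `|f x p - f x q| <= e) ->
    mcshane z p <= mcshane z q + e.
  have := key m m' fe; have := key m' m; rewrite ler_norml => k1 k2.
  have : mcshane z m' <= mcshane z m + e by apply: k1 => x; rewrite distrC; exact: fe.
  lra.
move=> pq; apply: le_inf_image => //; first exact: mcshane_has_lbound.
by move=> x Xx; have := pq x Xx; rewrite ler_norml; lra.
Qed.

End McShane.

(** Common form of both uses of McShane's formula. [E] is a class of functions on [M] containing the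
    McShane extensions, namely the continuous or the bounded ones, and [T] is a [c]-Lipschitz
    retraction of [E] onto [V]. *)
Lemma ext_const_of_projection (R : realType) (M : topologicalType)
    (V E : set (M -> R)) (T : (M -> R) -> (M -> R)) (Z : Type)
    (d : Z -> Z -> R) (c : R) :
  compact [set: M] -> fd_subspace V -> is_metric d -> 0 < c ->
  (forall f, E f -> V (T f)) -> (forall v, V v -> T v = v) ->
  (forall f g C m, E f -> E g -> (forall m, `|f m - g m| <= C) ->
     `|T f m - T g m| <= c * C) ->
  (forall (X : set Z) (f : Z -> M -> R) K z, X !=set0 -> 0 <= K ->
     (forall x, X x -> V (f x)) ->
     (forall x y, X x -> X y -> forall m, `|f x m - f y m| <= K * d x y) ->
     E (mcshane d X f K z)) ->
  ext_const V d c.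
Proof.
move=> cM fdV dm c0 TV Tid Tc mcE X f Vf.
have [_ V0 _ _ _] := fdV.
have [X0|nX0] := pselect (X !=set0); last first.
  exists (fun=> fun=> 0); split=> //; split.
    by move=> x Xx; exfalso; apply: nX0; exists x.
  rewrite (@le_trans _ _ 0%E)//; last first.
    by rewrite mule_ge0 ?lee_fin ?lipconst_ge0// ltW.
  by apply: lipconst_le => // x y _ _ m; rewrite subrr normr0 mul0r.
have := lipconst_ge0 d X f; case LE : (lipconst d X f) => [K| |] // K0.
  rewrite lee_fin in K0.
  have fK x y : X x -> X y -> forall m, `|f x m - f y m| <= K * d x y.
    move=> Xx Xy m; apply: (lipconst_ub dm m _ Xx Xy); first by rewrite LE.
    by apply: (fd_bounded cM fdV); apply: fd_sub => //; exact: Vf.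
  have EF z : E (mcshane d X f K z) by exact: mcE.
  exists (fun z => T (mcshane d X f K z)); split; first by move=> z; exact: TV.
  split; first by move=> x Xx; rewrite mcshane_extends// Tid//; exact: Vf.
  rewrite -EFinM; apply: lipconst_le => // [|x y _ _ m].
    by rewrite mulr_ge0// ltW.
  by rewrite -mulrA; apply: Tc => // p; exact: mcshane_lipschitz.
(* If [f] has infinite Lipschitz constant, any extension will do, because [c * +oo = +oo] for
   [c > 0]. *)
exists (fun z => if pselect (X z) then f z else fun=> 0); split.
  by move=> z; case: pselect => // Xz; exact: Vf.
split; first by move=> x Xx; case: pselect.
by rewrite gt0_muley ?lte_fin// leey.
Qed.

(** The slack [e] makes the constants strictly positive, as [ext_const_of_projection] requires. *)
Lemma lee_fin_addgt0 (R : realType) (x : \bar R) (p : R) :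
  (forall e, 0 < e -> (x <= (p + e)%:E)%E) -> (x <= p%:E)%E.
Proof. by move=> h; apply/lee_addgt0Pr => e e0; rewrite -EFinD; exact: h. Qed.

(** Rescale [h] by [C^-1] into the unit ball over which [opnorm] is taken; for [C = 0] the function
    [h] is zero. *)
Lemma opnorm_bound (R : realType) (M : topologicalType) (V : set (M -> R)) P p
    h C m :
  is_projection V P -> (opnorm P <= p%:E)%E -> compact [set: M] ->
  fd_subspace V -> continuous h -> (forall m, `|h m| <= C) ->
  `|P h m| <= p * C.
Proof.
move=> [_ PZ PV _] Pp cM fdV ch hC.
have : 0 <= C by rewrite (le_trans _ (hC m)).
rewrite le_eqVlt => /orP[/eqP C0|C0].
  have -> : h = fun x => 0 * h x.
    apply/funext => x; rewrite mul0r; apply/eqP.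
    by rewrite -normr_le0 [leRHS]C0 hC.
  by rewrite PZ// -C0 mul0r normr0 mulr0.
have ck : continuous (fun x => C^-1 * h x).
  by move=> x; apply: cvgMr; exact: ch.
have Pk : supnorm (P (fun x => C^-1 * h x)) <= p.
  rewrite -lee_fin (le_trans _ Pp)//; apply: ereal_sup_ubound.
  exists (fun x => C^-1 * h x) => //; split=> //.
  apply: supnorm_le => // x; rewrite normrM normfV (gtr0_norm C0).
  by rewrite ler_pdivrMl// mulr1.
have bk : is_bounded (P (fun x => C^-1 * h x)).
  by apply: (fd_bounded cM fdV); exact: PV.
have := le_trans (supnorm_ub m bk) Pk; rewrite PZ// normrM normfV (gtr0_norm C0).
by rewrite ler_pdivrMl// [C * p]mulrC.
Qed.

(** * Total boundedness and continuity of McShane extensions *)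

Lemma metric_ball_open (R : realType) (Z : Type) (d : Z -> Z -> R) z e :
  is_metric d -> metric_open d [set y | d z y < e].
Proof.
move=> [_ _ _ dD] x /= zx; exists (e - d z x); first by rewrite subr_gt0.
by move=> y xy /=; rewrite (le_lt_trans (dD z x y))// -ltrBrDl.
Qed.

(** Cover by balls of radius [e / 2]. The net consists of small sets rather than centres because the
    centres may lie outside [X]. *)
Lemma metric_compact_net (R : realType) (Z : Type) (d : Z -> Z -> R)
    (X : set Z) e :
  is_metric d -> metric_compact d -> 0 < e ->
  exists s : seq (set Z), (forall x, X x -> exists2 B, B \in s & B x) /\
    (forall B x y, B \in s -> B x -> B y -> d x y <= e).
Proof.
move=> dm dc e0; have [_ _ dC dD] := dm.
have [|z|s [sF scov]] := dc [set B | exists z, B = [set y | d z y < e / 2]].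
- by move=> _ [z ->]; exact: metric_ball_open.
- exists [set y | d z y < e / 2]; first by exists z.
  by rewrite /= is_metric_xx// divr_gt0.
exists s; split=> [x _|B x y /sF[z ->] /= zx zy]; first exact: scov.
by rewrite (le_trans (dD x z y))// (dC x z) ltW// [e]splitr ltrD.
Qed.

Lemma near_all_seq (I : eqType) (T : Type) (F : set_system T) (s : seq I)
    (P : I -> T -> Prop) :
  Filter F -> (forall i, i \in s -> \forall t \near F, P i t) ->
  \forall t \near F, forall i, i \in s -> P i t.
Proof.
move=> FF; elim: s => [|i s IH] Ps; first by apply: nearW => t i.
have Pi : \forall t \near F, P i t by apply: Ps; rewrite mem_head.
have {}IH : \forall t \near F, forall i, i \in s -> P i t.
  by apply: IH => j sj; apply: Ps; rewrite inE sj orbT.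
by apply: filterS2 Pi IH => t Pit Pst j; rewrite inE => /orP[/eqP ->|/Pst].
Qed.

(** It suffices that [f x m] is close to [f x m0] uniformly in [x]. Pick one point of [X] in each
    cell of a finite net: finitely many continuity conditions at [m0] hold together, and the
    Lipschitz bound carries them to the whole cell. *)
Lemma mcshane_continuous (R : realType) (M : topologicalType) (Z : Type)
    (d : Z -> Z -> R) (X : set Z) (f : Z -> M -> R) (K : R) z :
  is_metric d -> metric_compact d -> X !=set0 -> 0 <= K ->
  (forall x y, X x -> X y -> forall m, `|f x m - f y m| <= K * d x y) ->
  (forall x, X x -> continuous (f x)) ->
  continuous (mcshane d X f K z).
Proof.
move=> dm dc X0 K0 fK fc m0; apply/cvgrPdist_le => e e0.
(* With [K + 1] in place of [K] the quotient makes sense for [K = 0] too; cells of diameter [r] cost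
   [e / 3] at each of [m0] and [m]. *)
pose r := e / (3 * (K + 1)).
have K1 : 0 < 3 * (K + 1) by lra.
have r0 : 0 < r by rewrite divr_gt0.
have Kr : K * r <= e / 3.
  rewrite /r mulrA ler_pdivrMr//.
  have -> : e / 3 * (3 * (K + 1)) = e * K + e by field.
  by rewrite mulrC lerDl ltW.
have [s [scov sr]] := metric_compact_net X dm dc r0.
have net : \forall m \near m0, forall B, B \in s -> B `&` X !=set0 ->
    exists2 y, (B `&` X) y & `|f y m0 - f y m| <= e / 3.
  apply: near_all_seq => B sB.
  have [[y [By Xy]]|nB] := pselect (B `&` X !=set0); last exact: nearW.
  have /cvgrPdist_le/(_ (e / 3) _) := fc y Xy m0.
  rewrite divr_gt0// => /(_ isT); apply: filterS => m fm _.
  by exists y.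
apply: filterS net => m net.
apply: mcshane_dist => // x Xx.
have [B sB Bx] := scov x Xx.
have [|y [By Xy] fy] := net B sB; first by exists x.
have xy := fK x y Xx Xy; have dxy := ler_wpM2l K0 (sr B x y sB Bx By).
have := xy m0; have := xy m; move: fy; rewrite !ler_norml.
by move: dxy Kr; lra.
Qed.

(** * Inequalities between the constants *)

Lemma LEc_le_opnorm (R : realType) (M : topologicalType) (V : set (M -> R)) P :
  compact [set: M] -> fd_subspace V -> is_projection V P ->
  (LEc V <= opnorm P)%E.
Proof.
move=> cM fdV hP; have [PD PZ PV Pid] := hP.
have [cV V0 _ _ _] := fdV.
have P0 : (0 <= opnorm P)%E.
  apply: (@le_trans _ _ (supnorm (P (fun=> 0)))%:E).
    by rewrite lee_fin supnorm_ge0.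
  apply: ereal_sup_ubound; exists (fun=> 0) => //; split; first exact: cV.
  by apply: supnorm_le => // x; rewrite normr0.
case Pp : (opnorm P) P0 => [p| |] // p0; last by rewrite leey.
rewrite lee_fin in p0; apply: lee_fin_addgt0 => e e0.
apply: ereal_inf_lbound; exists (p + e) => //.
have pe0 : 0 < p + e by rewrite ltr_wpDl.
split; first exact: ltW.
move=> Z d dm dc.
apply: (ext_const_of_projection (E := [set f | continuous f]) (T := P)) => //.
- move=> f g C m cf cg fgC.
  have cNg : continuous (fun x => -1 * g x).
    by move=> x; apply: cvgMr; exact: cg.
  have -> : P f m - P g m = P (fun x => f x + -1 * g x) m.
    by rewrite PD// PZ// mulN1r.
  have Ppe : (opnorm P <= (p + e)%:E)%E by rewrite Pp lee_fin lerDl ltW.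
  apply: (opnorm_bound (V := V)) => //.
    by move=> x; apply: cvgD; [exact: cf | exact: cNg].
  by move=> x; rewrite mulN1r.
- move=> X f K z X0 K0 Vf fK; apply: mcshane_continuous => // x Xx.
  exact/cV/Vf.
Qed.

(** The projection constant is applied to the bounded functions on [M], and the projection is then
    read on plain functions, so that it serves McShane extensions and continuous functions alike. *)
Lemma linfty_projection (R : realType) (M : topologicalType) (V : set (M -> R))
    (c : R) :
  compact [set: M] -> fd_subspace V ->
  (forall (W : completeNormedModType R) (J : (M -> R) -> W), isom_embedding V J ->
      exists Q : W -> W,
        [/\ (forall (a : R) w1 w2, Q (a *: w1 + w2) = a *: Q w1 + Q w2),
            (forall w, exists2 v, V v & Q w = J v),
            (forall v, V v -> Q (J v) = J v) &
            (forall w, `|Q w| <= c * `|w|)]) -> 0 <= c ->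
  exists T : (M -> R) -> (M -> R),
    [/\ forall f, V (T f),
        forall v, V v -> T v = v,
        forall a f g, is_bounded f -> is_bounded g ->
          T (fun x => a * f x + g x) = (fun x => a * T f x + T g x) &
        forall f C m, (forall m, `|f m| <= C) -> `|T f m| <= c * C].
Proof.
move=> cM fdV hc c0.
(* Unbounded functions are sent to 0; members of [V] are bounded by compactness of [M]. *)
pose J (f : M -> R) : linfty R M := insubd 0 (f : M -> R^o).
have JE f : is_bounded f -> (J f : M -> R) = f.
  by move=> bf; rewrite /J -[LHS]/(val _) insubdK//; apply/mem_set.
have Jlin a f g : is_bounded f -> is_bounded g ->
    J (fun x => a * f x + g x) = a *: J f + J g.
  move=> bf bg; apply/val_inj => /=; apply/funext => x.
  rewrite -[LHS]/(linfty_fun (J _) x) JE; last first.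
    exact: is_boundedD (is_boundedZ _ bf) bg.
  by rewrite -[in LHS](JE f bf) -[in LHS](JE g bg).
have bV := fd_bounded cM fdV.
have hJ : isom_embedding V J.
  split=> [a u v Vu Vv|v Vv]; first by apply: Jlin; exact: bV.
  by rewrite linfty_normE JE//; exact: bV.
have [Q [Qlin QV QJ Qc]] := hc (linfty R M) J hJ.
exists (fun f => linfty_fun (Q (J f))); split.
- by move=> f; have [v Vv ->] := QV (J f); rewrite JE//; exact: bV.
- by move=> v Vv; rewrite QJ// JE//; exact: bV.
- by move=> a f g bf bg; rewrite Jlin// Qlin.
- move=> f C m fC; rewrite (le_trans (le_linfty_norm _ _))// (le_trans (Qc _))//.
  rewrite ler_wpM2l// linfty_normE JE; last by exists C.
  by apply: supnorm_le => //; rewrite (le_trans _ (fC m)).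
Qed.

Lemma LE_le_PC (R : realType) (M : topologicalType) (V : set (M -> R)) :
  compact [set: M] -> fd_subspace V -> (LE V <= PC V)%E.
Proof.
move=> cM fdV; apply: le_ereal_inf_tmp => _ [c [c0 hc] <-].
have [T [VT Tid Tlin Tc]] := linfty_projection cM fdV hc c0.
apply: lee_fin_addgt0 => e e0.
apply: ereal_inf_lbound; exists (c + e) => //.
have ce0 : 0 < c + e by rewrite ltr_wpDl.
split; first exact: ltW.
move=> Z d dm.
apply: (ext_const_of_projection (E := [set f | is_bounded f]) (T := T)) => //.
- move=> f g C m bf bg fgC.
  have -> : T f m - T g m = T (fun x => -1 * g x + f x) m.
    by rewrite Tlin// mulN1r addrC.
  apply: (@le_trans _ _ (c * C)).
    by apply: Tc => x; rewrite mulN1r addrC.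
  by rewrite ler_wpM2r ?lerDl ?(ltW e0)// (le_trans _ (fgC m)).
- move=> X f K z X0 K0 Vf fK; apply: mcshane_bounded => // x Xx.
  exact/(fd_bounded cM fdV)/Vf.
Qed.

Lemma LEc_le_LE (R : realType) (M : topologicalType) (V : set (M -> R)) :
  (LEc V <= LE V)%E.
Proof.
apply: le_ereal_inf => _ [c [c0 hc] <-]; exists c => //; split=> // Z d dm _.
exact: hc.
Qed.

Lemma minimal_opnorm_le_PC (R : realType) (M : topologicalType)
    (V : set (M -> R)) (P : (M -> R) -> (M -> R)) :
  compact [set: M] -> fd_subspace V ->
  (forall Q, is_projection V Q -> (opnorm P <= opnorm Q)%E) ->
  (opnorm P <= PC V)%E.
Proof.
move=> cM fdV Pmin; apply: le_ereal_inf_tmp => _ [c [c0 hc] <-].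
have [T [VT Tid Tlin Tc]] := linfty_projection cM fdV hc c0.
have bc (f : M -> R) : continuous f -> is_bounded f by exact: continuous_is_bounded.
(* Continuous functions on compact [M] are bounded, so [T] competes with [P], and its norm is at
   most [c]. *)
have hT : is_projection V T.
  split=> //.
  - move=> f g /bc bf /bc bg.
    have := Tlin 1 f g bf bg.
    under eq_fun do rewrite mul1r.
    by move=> ->; apply/funext => x; rewrite mul1r.
  - move=> a f /bc bf.
    have b0 : is_bounded (fun _ : M => 0 : R) by exists 0 => x; rewrite normr0.
    have [_ V0 _ _ _] := fdV.
    have := Tlin a f _ bf b0; rewrite (Tid _ V0).
    under eq_fun do rewrite addr0.
    by move=> ->; apply/funext => x; rewrite addr0.
apply: (le_trans (Pmin _ hT)); apply: ge_ereal_sup => _ [f [/bc bf f1] <-].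
rewrite lee_fin; apply: supnorm_le => // m; rewrite -[c]mulr1.
by apply: Tc => x; rewrite (le_trans (supnorm_ub x bf)).
Qed.

Theorem theorem5p2 (R : realType) (M : topologicalType)
    (V : set (M -> R)) (P : (M -> R) -> (M -> R)) :
  hausdorff_space M -> compact [set: M] ->
  fd_subspace V -> is_projection V P ->
  (LEc V <= opnorm P)%E /\
  ((forall Q : (M -> R) -> (M -> R), is_projection V Q -> (opnorm P <= opnorm Q)%E) ->
     PC V = opnorm P /\ LE V = opnorm P /\ LEc V = opnorm P).
Proof.
move=> _ cM fdV hP; have LP := LEc_le_opnorm cM fdV hP; split=> // Pmin.
have PPC := minimal_opnorm_le_PC cM fdV Pmin.
have PCL := PC_le_LEc cM fdV.
have LEPC := LE_le_PC cM fdV.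
have LEcLE := LEc_le_LE V.
(* The cycle [PC <= LEc <= ||P|| <= PC] closes; [LE] lies between [LEc] and [PC]. *)
have PCP : PC V = opnorm P.
  by apply/eqP; rewrite eq_le PPC (le_trans PCL).
have LEcP : LEc V = opnorm P.
  by apply/eqP; rewrite eq_le LP -PCP.
split=> //; split=> //.
by apply/eqP; rewrite eq_le -{1}PCP LEPC -LEcP.
Qed.
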